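(* Let $E$ be an arbitrary (countable, not necessarily row-finite) directed graph and $K$ a field. Then the Leavitt path algebra $L_K(E)$ has nonzero socle if and only if $P_l(E)\neq\emptyset$, i.e. if and only if $E$ has a line point.
   Context: A graph $E=(E^0,E^1,r,s)$ consists of countable sets $E^0$ (vertices), $E^1$ (edges) and maps $r,s:E^1\to E^0$ (range, source). A vertex $v$ is regular if $s^{-1}(v)$ is finite and nonempty. A path is a vertex (length $0$) or a sequence $\mu=e_1\cdots e_n$ of edges with $r(e_i)=s(e_{i+1})$; $s(\mu)=s(e_1)$, $r(\mu)=r(e_n)$. A cycle is a path $e_1\cdots e_n$ ($n\ge1$) with $s(e_1)=r(e_n)$ and $s(e_i)\neq s(e_j)$ for $i\ne j$. The Leavitt path algebra $L_K(E)$ is the $K$-algebra generated by a set $\{v: v\in E^0\}$ of pairwise orthogonal idempotents and elements $\{e,e^*: e\in E^1\}$ subject to: (1) $s(e)e=er(e)=e$; (2) $r(e)e^*=e^*s(e)=e^*$; (3) $e^*e'=\delta_{e,e'}r(e)$; (4) $v=\sum_{s(e)=v}ee^*$ for every regular vertex $v$. $T(v)$ is the set of vertices $w$ such that there is a path from $v$ to $w$ (length $0$ allowed). A vertex $v$ is a bifurcation if $|s^{-1}(v)|\ge 2$. A vertex $u$ is a line point if there are neither bifurcations nor cycles at any vertex $w\in T(u)$; $P_l(E)$ is the set of line points. $L_K(E)$ is semiprime; the socle of a semiprime ring is the sum of all its minimal left ideals (which equals the sum of all its minimal right ideals), and is $0$ if there are none. *)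

(* Defs.v *)
From HB Require Import structures.
From mathcomp Require Import all_boot all_order all_algebra.
From mathcomp Require Import finmap.
From mathcomp Require Import boolp classical_sets functions cardinality.

Set Implicit Arguments.
Unset Strict Implicit.
Unset Printing Implicit Defensive.

Import GRing.Theory.

Local Open Scope classical_set_scope.
Local Open Scope ring_scope.

(* Leavitt path algebras of graphs with infinitely many vertices have no unit, *)
(* while MathComp's ring structures are all unital.                            *)

HB.mixin Record Zmodule_isNonUnitalRing V of GRing.Zmodule V := {
  numul : V -> V -> V;
  numulA : associative numul;
  numulDl : left_distributive numul +%R;
  numulDr : right_distributive numul +%R
}.

#[short(type="nonUnitalRingType")]
HB.structure Definition NonUnitalRing :=
  { V of Zmodule_isNonUnitalRing V & GRing.Zmodule V }.

Notation "x ** y" := (numul x y) (at level 40, left associativity) : ring_scope.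

HB.mixin Record Lmodule_isNonUnitalAlgebra (K : comNzRingType) V
    of NonUnitalRing V & GRing.Lmodule K V := {
  scalenuAl : forall (a : K) (x y : V), a *: (x ** y) = (a *: x) ** y;
  scalenuAr : forall (a : K) (x y : V), a *: (x ** y) = x ** (a *: y)
}.

#[short(type="nonUnitalAlgType")]
HB.structure Definition NonUnitalAlgebra (K : comNzRingType) :=
  { V of Lmodule_isNonUnitalAlgebra K V & NonUnitalRing V & GRing.Lmodule K V }.

Definition left_ideal (R : nonUnitalRingType) (I : set R) : Prop :=
  [/\ I 0, forall x y, I x -> I y -> I (x - y) & forall a x, I x -> I (a ** x)].

Definition minimal_left_ideal (R : nonUnitalRingType) (I : set R) : Prop :=
  [/\ left_ideal I, I <> [set 0]
    & forall J : set R, left_ideal J -> J `<=` I -> J = [set 0] \/ J = I].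

Definition socle (R : nonUnitalRingType) : set R :=
  [set x | exists n (y : 'I_n -> R),
     (forall i, exists2 I : set R, minimal_left_ideal I & I (y i))
     /\ x = \sum_(i < n) y i].

Arguments socle : clear implicits.

Record graph := Graph {
  vertex : countType;
  edge : countType;
  src : edge -> vertex;
  rng : edge -> vertex
}.

Section GraphNotions.
Context (E : graph).
Implicit Types (u v w : vertex E) (p c : seq (edge E)).

Definition out_edges v : set (edge E) := [set e | src e = v].

Definition regular v : Prop := finite_set (out_edges v) /\ out_edges v !=set0.

(* [gpath v p w]: p is a path with source v and range w.  The path of length 0 *)
(* at v is represented by the empty sequence together with v = w.              *)
Fixpoint gpath v p w : bool :=
  if p is e :: p' then (src e == v) && gpath (rng e) p' w else v == w.

Definition tree v : set (vertex E) := [set w | exists p, gpath v p w].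

Definition bifurcation v : Prop := (`I_2 #<= out_edges v)%card.

Definition cycle_at v c : Prop :=
  [/\ c != [::], gpath v c v & uniq [seq src e | e <- c]].

Definition line_point u : Prop :=
  forall w, tree u w -> ~ bifurcation w /\ ~ exists c, cycle_at w c.

Definition line_points : set (vertex E) := [set u | line_point u].

End GraphNotions.

Arguments line_points : clear implicits.

(* L_K(E) is the quotient of the non-unital algebra expressions over the       *)
(* generators v, e, e^* by the smallest congruence containing the axioms of    *)
(* non-unital associative K-algebras and the Leavitt relations.                *)

Inductive lterm (K : fieldType) (E : graph) : Type :=
| LVert of vertex E
| LEdge of edge E
| LGhost of edge E
| LZero
| LAdd of lterm K E & lterm K E
| LOpp of lterm K E
| LScale of K & lterm K E
| LMul of lterm K E & lterm K E.

Arguments LVert {K E}.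
Arguments LEdge {K E}.
Arguments LGhost {K E}.
Arguments LZero {K E}.

Inductive lcong (K : fieldType) (E : graph) : lterm K E -> lterm K E -> Prop :=
| lc_refl x : lcong x x
| lc_sym x y : lcong x y -> lcong y x
| lc_trans x y z : lcong x y -> lcong y z -> lcong x z
| lc_add x x' y y' : lcong x x' -> lcong y y' -> lcong (LAdd x y) (LAdd x' y')
| lc_opp x x' : lcong x x' -> lcong (LOpp x) (LOpp x')
| lc_scale a x x' : lcong x x' -> lcong (LScale a x) (LScale a x')
| lc_mul x x' y y' : lcong x x' -> lcong y y' -> lcong (LMul x y) (LMul x' y')
| lc_addA x y z : lcong (LAdd x (LAdd y z)) (LAdd (LAdd x y) z)
| lc_addC x y : lcong (LAdd x y) (LAdd y x)
| lc_add0 x : lcong (LAdd LZero x) x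
| lc_addN x : lcong (LAdd (LOpp x) x) LZero
| lc_scaleA a b x : lcong (LScale a (LScale b x)) (LScale (a * b) x)
| lc_scale1 x : lcong (LScale 1 x) x
| lc_scaleDr a x y : lcong (LScale a (LAdd x y)) (LAdd (LScale a x) (LScale a y))
| lc_scaleDl a b x : lcong (LScale (a + b) x) (LAdd (LScale a x) (LScale b x))
| lc_mulA x y z : lcong (LMul x (LMul y z)) (LMul (LMul x y) z)
| lc_mulDl x y z : lcong (LMul (LAdd x y) z) (LAdd (LMul x z) (LMul y z))
| lc_mulDr x y z : lcong (LMul x (LAdd y z)) (LAdd (LMul x y) (LMul x z))
| lc_scaleAl a x y : lcong (LScale a (LMul x y)) (LMul (LScale a x) y)
| lc_scaleAr a x y : lcong (LScale a (LMul x y)) (LMul x (LScale a y))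
| lc_vert v w :
    lcong (LMul (LVert v) (LVert w)) (if v == w then LVert v else LZero)
| lc_src_edge e : lcong (LMul (LVert (src e)) (LEdge e)) (LEdge e)
| lc_edge_rng e : lcong (LMul (LEdge e) (LVert (rng e))) (LEdge e)
| lc_rng_ghost e : lcong (LMul (LVert (rng e)) (LGhost e)) (LGhost e)
| lc_ghost_src e : lcong (LMul (LGhost e) (LVert (src e))) (LGhost e)
| lc_ghost_edge e f :
    lcong (LMul (LGhost e) (LEdge f)) (if e == f then LVert (rng e) else LZero)
| lc_regular v : regular v ->
    lcong (LVert v)
      (\big[@LAdd K E/LZero]_(e <- fset_set (out_edges v))
         LMul (LEdge e) (LGhost e)).

HB.instance Definition _ (K : fieldType) (E : graph) :=
  gen_eqMixin (lterm K E).
HB.instance Definition _ (K : fieldType) (E : graph) :=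
  gen_choiceMixin (lterm K E).

Section LeavittPathAlgebra.
Local Open Scope quotient_scope.
Context (K : fieldType) (E : graph).

Definition lequiv (x y : lterm K E) : bool := `[< lcong x y >].

Lemma lequiv_refl : reflexive lequiv.
Proof. by move=> x; apply/asboolP; exact: lc_refl. Qed.

Lemma lequiv_sym : symmetric lequiv.
Proof. by move=> x y; apply/asboolP/asboolP; exact: lc_sym. Qed.

Lemma lequiv_trans : transitive lequiv.
Proof.
by move=> y x z /asboolP xy /asboolP yz; apply/asboolP; exact: lc_trans xy yz.
Qed.

Canonical lequiv_equiv := EquivRel lequiv lequiv_refl lequiv_sym lequiv_trans.

Definition leavitt : Type := {eq_quot lequiv_equiv}.

HB.instance Definition _ := Choice.on leavitt.
HB.instance Definition _ := EqQuotient.on leavitt.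

Definition lclass (x : lterm K E) : leavitt := \pi_leavitt x.

Lemma lclassP (x y : lterm K E) : lclass x = lclass y <-> lcong x y.
Proof.
by split=> [/eqmodP/asboolP //|xy]; apply/eqmodP/asboolP.
Qed.

Lemma lclass_repr (x : leavitt) : lclass (repr x) = x.
Proof. exact: reprK. Qed.

Lemma lcong_repr (x : lterm K E) : lcong (repr (lclass x)) x.
Proof. by apply/lclassP; exact: lclass_repr. Qed.

Definition lzero : leavitt := lclass LZero.
Definition ladd (x y : leavitt) : leavitt := lclass (LAdd (repr x) (repr y)).
Definition lopp (x : leavitt) : leavitt := lclass (LOpp (repr x)).
Definition lscale (a : K) (x : leavitt) : leavitt := lclass (LScale a (repr x)).
Definition lmul (x y : leavitt) : leavitt := lclass (LMul (repr x) (repr y)).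

Lemma laddE x y : ladd (lclass x) (lclass y) = lclass (LAdd x y).
Proof. by apply/lclassP/lc_add; exact: lcong_repr. Qed.

Lemma loppE x : lopp (lclass x) = lclass (LOpp x).
Proof. by apply/lclassP/lc_opp; exact: lcong_repr. Qed.

Lemma lscaleE a x : lscale a (lclass x) = lclass (LScale a x).
Proof. by apply/lclassP/lc_scale; exact: lcong_repr. Qed.

Lemma lmulE x y : lmul (lclass x) (lclass y) = lclass (LMul x y).
Proof. by apply/lclassP/lc_mul; exact: lcong_repr. Qed.

Let lE := (laddE, loppE, lscaleE, lmulE).

Lemma leavitt_ind (P : leavitt -> Prop) :
  (forall x, P (lclass x)) -> forall x, P x.
Proof. by move=> Pc x; rewrite -(lclass_repr x). Qed.

Lemma laddA : associative ladd.
Proof.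
elim/leavitt_ind=> x; elim/leavitt_ind=> y; elim/leavitt_ind=> z.
by rewrite !lE; apply/lclassP; exact: lc_addA.
Qed.

Lemma laddC : commutative ladd.
Proof.
elim/leavitt_ind=> x; elim/leavitt_ind=> y.
by rewrite !lE; apply/lclassP; exact: lc_addC.
Qed.

Lemma ladd0 : left_id lzero ladd.
Proof.
by elim/leavitt_ind=> x; rewrite !lE; apply/lclassP; exact: lc_add0.
Qed.

Lemma laddN : left_inverse lzero lopp ladd.
Proof.
by elim/leavitt_ind=> x; rewrite !lE; apply/lclassP; exact: lc_addN.
Qed.

HB.instance Definition _ :=
  GRing.isZmodule.Build leavitt laddA laddC ladd0 laddN.

Lemma lscaleA a b x : lscale a (lscale b x) = lscale (a * b) x.
Proof.
by elim/leavitt_ind: x => x; rewrite !lE; apply/lclassP; exact: lc_scaleA.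
Qed.

Lemma lscale1 : left_id 1 lscale.
Proof.
by elim/leavitt_ind=> x; rewrite !lE; apply/lclassP; exact: lc_scale1.
Qed.

Lemma lscaleDr : right_distributive lscale +%R.
Proof.
move=> a; elim/leavitt_ind=> x; elim/leavitt_ind=> y.
by rewrite /GRing.add /= !lE; apply/lclassP; exact: lc_scaleDr.
Qed.

Lemma lscaleDl x : {morph lscale^~ x : a b / a + b}.
Proof.
move=> a b; elim/leavitt_ind: x => x.
by rewrite [RHS]/GRing.add /= !lE; apply/lclassP; exact: lc_scaleDl.
Qed.

HB.instance Definition _ :=
  GRing.Zmodule_isLmodule.Build K leavitt lscaleA lscale1 lscaleDr lscaleDl.

Lemma lmulA : associative lmul.
Proof.
elim/leavitt_ind=> x; elim/leavitt_ind=> y; elim/leavitt_ind=> z.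
by rewrite !lE; apply/lclassP; exact: lc_mulA.
Qed.

Lemma lmulDl : left_distributive lmul +%R.
Proof.
elim/leavitt_ind=> x; elim/leavitt_ind=> y; elim/leavitt_ind=> z.
by rewrite /GRing.add /= !lE; apply/lclassP; exact: lc_mulDl.
Qed.

Lemma lmulDr : right_distributive lmul +%R.
Proof.
elim/leavitt_ind=> x; elim/leavitt_ind=> y; elim/leavitt_ind=> z.
by rewrite /GRing.add /= !lE; apply/lclassP; exact: lc_mulDr.
Qed.

HB.instance Definition _ :=
  Zmodule_isNonUnitalRing.Build leavitt lmulA lmulDl lmulDr.

Lemma lscaleAl (a : K) (x y : leavitt) : a *: (x ** y) = (a *: x) ** y.
Proof.
elim/leavitt_ind: x => x; elim/leavitt_ind: y => y.
by rewrite /GRing.scale /numul /= !lE; apply/lclassP; exact: lc_scaleAl.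
Qed.

Lemma lscaleAr (a : K) (x y : leavitt) : a *: (x ** y) = x ** (a *: y).
Proof.
elim/leavitt_ind: x => x; elim/leavitt_ind: y => y.
by rewrite /GRing.scale /numul /= !lE; apply/lclassP; exact: lc_scaleAr.
Qed.

HB.instance Definition _ :=
  Lmodule_isNonUnitalAlgebra.Build K leavitt lscaleAl lscaleAr.

End LeavittPathAlgebra.

(* Main.v *)
(* With y <> 0 arbitrary, there are an element a and a path p such that a y p is
   a vertex w, or w plus a combination of nontrivial closed paths at a vertex w
   whose tree has no bifurcation. If u is a line point, p p^* is the source of p
   for the paths p from u, so u is a left multiple of every nonzero y u: the left
   ideal L u is minimal. Conversely, let y generate a minimal left ideal, so that
   a y p is a left multiple of each of its nonzero left multiples. Suppose that it
   is w plus closed paths, or that it is a vertex with a vertex w in its tree that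
   lies on a cycle c without exit; multiplying by w - c contradicts a representation
   in which c acts as a power of the variable of K[x, 1/x]. So a y p is a vertex w,
   and a bifurcation with edges e, f in the tree of w would make e e^* contradict
   this minimality. Hence w is a line point. *)
From HB Require Import structures.
Require Import Defs.
From mathcomp Require Import all_boot all_order all_algebra.
From mathcomp Require Import finmap.
From mathcomp Require Import boolp classical_sets functions cardinality.

Set Implicit Arguments.
Unset Strict Implicit.
Unset Printing Implicit Defensive.

Import GRing.Theory.

Local Open Scope classical_set_scope.
Local Open Scope ring_scope.

(** * Left ideals and socle of a ring without unit *)

Section NonUnitalRingTheory.
Context (R : nonUnitalRingType).
Implicit Types x y z : R.

Lemma numul0l x : 0 ** x = 0.
Proof. by apply: (addrI (0 ** x)); rewrite -numulDl !addr0. Qed.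

Lemma numulr0 x : x ** 0 = 0.
Proof. by apply: (addrI (x ** 0)); rewrite -numulDr !addr0. Qed.

Lemma numulNl x y : (- x) ** y = - (x ** y).
Proof. by apply: (addrI (x ** y)); rewrite -numulDl !subrr numul0l. Qed.

Lemma numulBl x y z : (x - y) ** z = x ** z - y ** z.
Proof. by rewrite numulDl numulNl. Qed.

Lemma numul_suml I (r : seq I) (P : pred I) (F : I -> R) x :
  (\sum_(i <- r | P i) F i) ** x = \sum_(i <- r | P i) F i ** x.
Proof.
exact: (big_morph (fun y => y ** x) (fun y z => numulDl y z x) (numul0l x)).
Qed.

Lemma numul_sumr I (r : seq I) (P : pred I) (F : I -> R) x :
  x ** (\sum_(i <- r | P i) F i) = \sum_(i <- r | P i) x ** F i.
Proof. exact: (big_morph (numul x) (numulDr x) (numulr0 x)). Qed.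

(** Without a unit, [x] itself need not belong to this left ideal. *)
Lemma left_ideal_principal x : left_ideal [set y | exists a, y = a ** x].
Proof.
split; first by exists 0; rewrite numul0l.
- by move=> _ _ [a ->] [b ->]; exists (a - b); rewrite numulBl.
- by move=> b _ [a ->]; exists (b ** a); rewrite numulA.
Qed.

Lemma left_ideal_neq0 (I : set R) :
  left_ideal I -> I <> [set 0] -> exists2 x, I x & x <> 0.
Proof.
move=> [I0 _ _] nI0; apply: contrapT => noI; apply: nI0.
apply/seteqP; split=> [x Ix|_ -> //].
by apply: contrapT => x0; apply: noI; exists x.
Qed.

(** If there is no minimal left ideal, only the empty sum is available; a nonzero element of a
    minimal left ideal is a sum of length one. *)
Lemma socle_neq0P :
  socle R <> [set 0] <-> exists I : set R, minimal_left_ideal I.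
Proof.
have socle0 : socle R 0.
  by exists 0%N, (fun=> 0); split; [case | rewrite big_ord0].
split=> [/eqP/negP soc|[I minI]].
- apply: contrapT => noI; apply: soc; apply/eqP/seteqP; split; last by move=> _ ->.
  move=> x [[|n] [y [Iy ->]]]; first by rewrite big_ord0.
  by have [I minI _] := Iy ord0; case: noI; exists I.
- have [idI nI0 _] := minI; have [x Ix x0] := left_ideal_neq0 idI nI0.
  move=> soc; apply: x0; suff: socle R x by rewrite soc.
  exists 1%N, (fun=> x); split; last by rewrite big_ord1.
  by move=> _; exists I.
Qed.

End NonUnitalRingTheory.

(** * Paths, trees, bifurcations and cycles *)

Section GraphTheory.
Context (E : graph).
Implicit Types (u v w : vertex E) (p q : seq (edge E)) (e f : edge E).

(** Weaker than [line_point]: a vertex on a cycle without exit qualifies. *)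
Definition no_bifurcation v : Prop := forall w, tree v w -> ~ bifurcation w.

Lemma gpath_cat v p w q t : gpath v p w -> gpath w q t -> gpath v (p ++ q) t.
Proof.
elim: p v => [|e p IH] v /= => [/eqP -> //|/andP[-> vp] wq]; exact: IH.
Qed.

Lemma gpath_catP v p q t :
  reflect (exists2 w, gpath v p w & gpath w q t) (gpath v (p ++ q) t).
Proof.
apply: (iffP idP) => [|[w]]; last exact: gpath_cat.
elim: p v => [|e p IH] v /=; first by exists v.
by case/andP=> -> /IH[w]; exists w.
Qed.

Lemma gpath_rng v p w w' : gpath v p w -> gpath v p w' -> w = w'.
Proof.
elim: p v => [|e p IH] v /= => [/eqP <- /eqP //|/andP[_ pw] /andP[_]].
exact: IH pw.
Qed.

Lemma tree_refl v : tree v v.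
Proof. by exists [::] => /=. Qed.

Lemma tree_trans v w t : tree v w -> tree w t -> tree v t.
Proof. by move=> [p vp] [q wq]; exists (p ++ q); apply: gpath_cat wq. Qed.

Lemma tree_rng e : tree (src e) (rng e).
Proof. by exists [:: e]; rewrite /= !eqxx. Qed.

Lemma no_bifurcation_tree v w :
  no_bifurcation v -> tree v w -> no_bifurcation w.
Proof. by move=> nbv vw t wt; apply: nbv; apply: tree_trans wt. Qed.

Lemma bifurcationP v :
  bifurcation v <-> exists e f, [/\ src e = v, src f = v & e <> f].
Proof.
split.
- move=> /card_leP[f].
  have I0 : (0%N \in `I_2) by rewrite inE.
  have I1 : (1%N \in `I_2) by rewrite inE.
  exists (val (f (SigSub I0))), (val (f (SigSub I1))).
  split; [exact: (set_mem (valP (f _))) | exact: (set_mem (valP (f _))) |].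
  move=> /val_inj f01.
  by have /(congr1 val) := 'inj_f (in_setT _) (in_setT _) f01.
- move=> [e [f [ev fv ef]]].
  have /injfunPex[g] : exists2 g : nat -> edge E,
      set_fun `I_2 (out_edges v) g & set_inj `I_2 g.
    exists (fun n => if n == 0%N then e else f); first by move=> n _; case: ifP.
    by move=> [|[|m]] [|[|n]]; rewrite !inE //= => _ _ h; case: ef.
  exact: inj_card_le.
Qed.

Lemma no_bifurcation_uniq v e f :
  no_bifurcation v -> src e = v -> src f = v -> e = f.
Proof.
move=> nbv ev fv; apply: contrapT => ef.
by apply: (nbv _ (tree_refl v)); apply/bifurcationP; exists e, f.
Qed.

Lemma no_bifurcation_out e :
  no_bifurcation (src e) -> out_edges (src e) = [set e].
Proof.
move=> nbe; apply/seteqP; split=> [f fe|_ -> //] /=.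
exact: no_bifurcation_uniq nbe _ _.
Qed.

(* A closed path of minimal length repeats no source. *)
Lemma closed_path_cycle v p :
  p != [::] -> gpath v p v -> exists c, cycle_at v c.
Proof.
have [n] := ubnP (size p); elim: n p => // n IH p ltpn p0 vp.
have [up|/(uniqPn v)[i [j [ltij ltj eqij]]]] := boolP (uniq [seq src e | e <- p]).
  by exists p.
rewrite size_map in ltj; have lti := ltn_trans ltij ltj.
case: p => [//|e0 p'] in ltpn p0 vp ltj lti eqij *.
set p := e0 :: p' in ltpn p0 vp ltj lti eqij *.
rewrite !(nth_map e0) // in eqij.
(* Cutting out the segment between two edges with equal sources leaves a shorter closed path,
   nonempty since it keeps the edge at position [j]. *)
apply: (IH (take i p ++ drop j p)).
- rewrite size_cat size_drop size_takel; last exact: ltnW.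
  apply: leq_trans (ltnSE ltpn); rewrite -{2}(subnKC (ltnW ltj)).
  by rewrite ltn_add2r.
- rewrite -size_eq0 size_cat size_drop addn_eq0 negb_and.
  by rewrite subn_eq0 -ltnNge ltj orbT.
- have := vp; rewrite -{1}(cat_take_drop i p) => /gpath_catP[w vw].
  have := vp; rewrite -{1}(cat_take_drop j p) => /gpath_catP[w' _].
  rewrite (drop_nth e0 lti) (drop_nth e0 ltj) /= => /andP[/eqP wj pj] /andP[/eqP wi pi].
  by apply: (gpath_cat vw); rewrite /= -wi eqij eqxx.
Qed.

End GraphTheory.

(** * Generators and paths *)

Section Generators.
Context (K : fieldType) (E : graph).
Local Notation L := (leavitt K E).
Implicit Types (u v w : vertex E) (p q : seq (edge E)) (e f : edge E).
Implicit Types (x y z : L).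

Definition lv v : L := lclass (LVert v).
Definition le e : L := lclass (LEdge e).
Definition lg e : L := lclass (LGhost e).

(** Opposites need no case of their own, being multiples by [-1]. *)
Lemma leavitt_gen_ind (P : L -> Prop) :
  (forall v, P (lv v)) -> (forall e, P (le e)) -> (forall e, P (lg e)) ->
  (forall x y, P x -> P y -> P (x + y)) ->
  (forall a x, P x -> P (a *: x)) ->
  (forall x y, P x -> P y -> P (x ** y)) ->
  P 0 -> forall x, P x.
Proof.
move=> Pv Pe Pg PD PZ PM P0; apply: leavitt_ind.
elim=> [v|e|e||s Ps t Pt|s Ps|a s Ps|s Ps t Pt].
- exact: Pv.
- exact: Pe.
- exact: Pg.
- exact: P0.
- by rewrite -laddE; exact: PD.
- rewrite -loppE; have -> : lopp (lclass s) = -1 *: (lclass s : L).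
    by rewrite scaleN1r.
  exact: PZ.
- by rewrite -lscaleE; exact: PZ.
- by rewrite -lmulE; exact: PM.
Qed.

Lemma lvM v w : lv v ** lv w = if v == w then lv v else 0.
Proof.
rewrite /numul /= lmulE.
transitivity (lclass (if v == w then LVert v else LZero : lterm K E)).
  by apply/lclassP; exact: lc_vert.
by case: ifP.
Qed.

Lemma lvv v : lv v ** lv v = lv v.
Proof. by rewrite lvM eqxx. Qed.

Lemma lv_le e : lv (src e) ** le e = le e.
Proof. by rewrite /numul /= lmulE; apply/lclassP; exact: lc_src_edge. Qed.

Lemma le_lv e : le e ** lv (rng e) = le e.
Proof. by rewrite /numul /= lmulE; apply/lclassP; exact: lc_edge_rng. Qed.

Lemma lv_lg e : lv (rng e) ** lg e = lg e.
Proof. by rewrite /numul /= lmulE; apply/lclassP; exact: lc_rng_ghost. Qed.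

Lemma lg_lv e : lg e ** lv (src e) = lg e.
Proof. by rewrite /numul /= lmulE; apply/lclassP; exact: lc_ghost_src. Qed.

Lemma lg_le e f : lg e ** le f = if e == f then lv (rng e) else 0.
Proof.
rewrite /numul /= lmulE.
transitivity (lclass (if e == f then LVert (rng e) else LZero : lterm K E)).
  by apply/lclassP; exact: lc_ghost_edge.
by case: ifP.
Qed.

(** Relation (4), freed from the particular enumeration used in the presentation. *)
Lemma lv_regular v (s : seq (edge E)) : uniq s -> s != [::] ->
  (forall e, (e \in s) = (src e == v)) -> lv v = \sum_(e <- s) le e ** lg e.
Proof.
move=> us s0 sE.
have out_s : out_edges v = [set` s].
  by apply/seteqP; split=> e /=; rewrite sE => /eqP.
have fin_out : finite_set (out_edges v).
  rewrite out_s; exact: finite_seq.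
have reg_v : regular v.
  split=> //; case: s s0 sE {us out_s} => [//|e s] _ /(_ e).
  by rewrite mem_head => /esym/eqP ev; exists e.
have -> : lv v = lclass (\big[@LAdd K E/LZero]_(e <- fset_set (out_edges v))
         LMul (LEdge e) (LGhost e)).
  by apply/lclassP; exact: lc_regular.
rewrite (big_morph (@lclass K E) (id1 := 0) (op1 := +%R)) //; last first.
  by move=> t t'; rewrite /GRing.add /= laddE.
transitivity (\sum_(e <- fset_set (out_edges v)) le e ** lg e).
  by apply: eq_bigr => e _; rewrite /numul /= lmulE.
apply: perm_big; apply: uniq_perm => // e.
rewrite in_fset_set // out_s; apply/idP/idP; rewrite inE //.
Qed.

Lemma lv_le_if v e : lv v ** le e = if src e == v then le e else 0.
Proof.
rewrite -{1}(lv_le e) numulA lvM [v == _]eq_sym; case: eqP => [<-|_].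
  exact: lv_le.
by rewrite numul0l.
Qed.

Lemma lg_lv_if v e : lg e ** lv v = if src e == v then lg e else 0.
Proof.
rewrite -{1}(lg_lv e) -numulA lvM; case: eqP => [_|_].
  exact: lg_lv.
by rewrite numulr0.
Qed.

(* The vertex [w] is meant to be the range of [p]. *)
Definition real_path p w : L := foldr (fun e x => le e ** x) (lv w) p.
Definition ghost_path p w : L := foldr (fun e x => x ** lg e) (lv w) p.

Lemma real_path_lv p w : real_path p w ** lv w = real_path p w.
Proof. by elim: p => [|e p IH] /=; rewrite ?lvv // -numulA IH. Qed.

Lemma lv_real_path v p w : gpath v p w -> lv v ** real_path p w = real_path p w.
Proof.
case: p => [|e p] /= => [/eqP ->|/andP[/eqP <- _]]; first exact: lvv.
by rewrite numulA lv_le.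
Qed.

Lemma ghost_path_lv v p w :
  gpath v p w -> ghost_path p w ** lv v = ghost_path p w.
Proof.
case: p => [|e p] /= => [/eqP ->|/andP[/eqP <- _]]; first exact: lvv.
by rewrite -numulA lg_lv.
Qed.

Lemma lv_real_path_if v p w : lv v ** real_path p w = real_path p w \/
  lv v ** real_path p w = 0.
Proof.
case: p => [|e p] /=; first by rewrite lvM; case: eqP => [->|]; [left|right].
rewrite numulA lv_le_if; case: eqP => _; first by left.
by right; rewrite numul0l.
Qed.

Lemma real_path_cat p q v w : gpath v q w ->
  real_path (p ++ q) w = real_path p v ** real_path q w.
Proof.
move=> vqw; elim: p => [|e p IH] /=; first by rewrite lv_real_path.
by rewrite IH numulA.
Qed.

Lemma real_path_rcons p e :
  real_path (rcons p e) (rng e) = real_path p (src e) ** le e.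
Proof.
rewrite -cats1 (@real_path_cat _ _ (src e)) /= ?eqxx //.
by rewrite le_lv.
Qed.

(** Where two consecutive edges do not match, or the last edge does not end at [w], two distinct
    orthogonal vertices meet in the product. *)
Lemma real_path_invalid p w :
  (forall v, ~~ gpath v p w) -> real_path p w = 0.
Proof.
case: p => [|e p]; first by move/(_ w); rewrite /= eqxx.
elim: p e => [|f p IH] e inv /=.
  rewrite -le_lv -numulA lvM; case: eqP => [ew|_]; last by rewrite numulr0.
  by have := inv (src e); rewrite /= ew !eqxx.
have [ef|ef] := eqVneq (rng e) (src f).
  have := IH f; rewrite /= => ->; first by rewrite numulr0.
  move=> v; have := inv (src e); rewrite /= eqxx /= ef eqxx /=.
  by apply: contra => /andP[_ ->].
by rewrite -le_lv -numulA (numulA (lv _)) lv_le_if eq_sym (negPf ef) numul0l numulr0.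
Qed.

Lemma ghost_real v p w : gpath v p w -> ghost_path p w ** real_path p w = lv w.
Proof.
elim: p v => [|e p IH] v /= => [_|/andP[_ ep]]; first exact: lvv.
rewrite numulA -[_ ** lg e ** le e]numulA lg_le eqxx.
by rewrite -numulA lv_real_path // (IH _ ep).
Qed.

Lemma ghost_real_neq p w w' : w != w' -> ghost_path p w ** real_path p w' = 0.
Proof.
move=> ww'; elim: p => [|e p IH] /=; first by rewrite lvM (negPf ww').
rewrite numulA -[_ ** lg e ** le e]numulA lg_le eqxx -numulA.
by case: (lv_real_path_if (rng e) p w') => -> //; rewrite numulr0.
Qed.

Lemma ghost_real_prefix v p q w t : gpath v p w -> gpath w q t ->
  ghost_path p w ** real_path (p ++ q) t = real_path q t.
Proof.
move=> vp wq; rewrite (real_path_cat _ wq) numulA (ghost_real vp).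
exact: lv_real_path.
Qed.

(** Cancelling the common initial edges leaves a factor [e^* f] with [e] and [f] distinct. *)
Lemma ghost_real_not_prefix p q w t : ~~ prefix p q -> ~~ prefix q p ->
  ghost_path p w ** real_path q t = 0.
Proof.
elim: p q => [|e p IH] [|f q] //=.
rewrite numulA -[_ ** lg e ** le f]numulA lg_le [f == e]eq_sym.
case: eqP => [->|_ _ _] /=; last by rewrite numulr0 numul0l.
move=> npq nqp; rewrite -numulA; case: (lv_real_path_if (rng f) q t) => ->.
  exact: IH.
by rewrite numulr0.
Qed.

(** Every vertex along [p] emits a single edge [e], so relation (4) there reads [e e^* = src e]. *)
Lemma real_ghost v p w : no_bifurcation v -> gpath v p w ->
  real_path p w ** ghost_path p w = lv v.
Proof.
elim: p v => [|e p IH] v nbv /= => [/eqP ->|/andP[/eqP ev ep]]; first exact: lvv.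
subst v; rewrite numulA -[le e ** _ ** _]numulA (IH _ _ ep); last first.
  exact: no_bifurcation_tree nbv (tree_rng e).
rewrite le_lv [RHS](@lv_regular _ [:: e]) //; first by rewrite big_seq1.
move=> f; rewrite inE; apply/eqP/eqP => [-> //|fe].
exact: no_bifurcation_uniq nbv _ _.
Qed.

End Generators.

(** * A representation on functions *)

Section Coding.
Context (E : graph).
Implicit Types (v w : vertex E) (e f : edge E) (n m : nat).

Definition out_seq v : seq (edge E) := fset_set (out_edges v).

(* [{v} * nat] is to contain the disjoint union of the [{rng e} * nat] over the
   edges [e] leaving [v], all of it when [v] is regular.  When [v] emits a single
   edge, the encoding is the identity. *)
Definition encode e m : nat :=
  if `[< finite_set (out_edges (src e)) >]
  then (m * size (out_seq (src e)) + index e (out_seq (src e)))%N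
  else choice.pickle (e, m).

(** The value [None] marks numbers that encode no pair; it can occur only when [v] is not
    regular. *)
Definition decode v n : option (edge E * nat) :=
  if `[< finite_set (out_edges v) >]
  then omap (fun e => (e, n %/ size (out_seq v))%N)
         (onth (out_seq v) (n %% size (out_seq v))%N)
  else if pickle_inv n is Some (e, m) then
         if src e == v then Some (e, m) else None
       else None.

Lemma mem_out_seq v e :
  finite_set (out_edges v) -> (e \in out_seq v) = (src e == v).
Proof.
by move=> finv; rewrite in_fset_set //; apply/idP/eqP; rewrite inE.
Qed.

Lemma encodeK e m : decode (src e) (encode e m) = Some (e, m).
Proof.
rewrite /decode /encode; case: asboolP => fine; last first.
  by rewrite pickleK_inv eqxx.
have es : e \in out_seq (src e) by rewrite mem_out_seq.
have lt_e := es; rewrite -index_mem in lt_e.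
rewrite modnMDl modn_small // divnMDl ?divn_small ?addn0; last 2 first.
- by [].
- exact: leq_ltn_trans lt_e.
by rewrite onthE (nth_map e) // nth_index.
Qed.

Lemma decodeK v n e m : decode v n = Some (e, m) -> src e = v /\ encode e m = n.
Proof.
rewrite /decode /encode; case: asboolP => finv.
  case def_e: (onth _ _) => [f|] //= [<- <-].
  have lt_s : (n %% size (out_seq v) < size (out_seq v))%N.
    by rewrite -onthTE def_e.
  have nth_f : nth f (out_seq v) (n %% size (out_seq v)) = f.
    exact: onth_nth.
  have fs : f \in out_seq v by rewrite -nth_f mem_nth.
  have fv : src f = v by apply/eqP; rewrite -mem_out_seq.
  have idx_f : index f (out_seq v) = (n %% size (out_seq v))%N.
    by rewrite -{1}nth_f index_uniq ?fset_uniq.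
  by split=> //; rewrite fv asboolT // idx_f -divn_eq.
case def_n: (pickle_inv n) => [[f k]|] //; case: eqP => // fv [<- <-].
split=> //; rewrite fv asboolF //.
by have := @pickle_invK (edge E * nat)%type n; rewrite def_n.
Qed.

(** This surjectivity of the encoding is what makes relation (4) hold in the representation. *)
Lemma decode_regular v n : regular v -> exists p, decode v n = Some p.
Proof.
move=> [finv [e ev]]; rewrite /decode asboolT //.
have : (n %% size (out_seq v) < size (out_seq v))%N.
  rewrite ltn_mod lt0n size_eq0; apply/eqP => s0.
  by have := mem_out_seq e finv; rewrite s0 ev eqxx.
by rewrite -onthTE; case: (onth _ _) => //= f _; eexists.
Qed.

Lemma decode_no_bifurcation e n :
  no_bifurcation (src e) -> decode (src e) n = Some (e, n).
Proof.
move=> nbe; have oute := no_bifurcation_out nbe.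
rewrite /decode /out_seq oute asboolT; last exact: finite_set1.
have -> : fset_set [set e] = [:: e] :> seq (edge E).
  apply: perm_small_eq => //; apply: uniq_perm; rewrite ?fset_uniq // => f.
  by rewrite fset_set1 !inE.
by rewrite /= modn1 divn1.
Qed.

End Coding.

(** * The action of the Leavitt path algebra on functions *)

Section Representation.
Context (K : fieldType) (E : graph) (A : fieldType).
Context (iota : {rmorphism K -> A}) (u : A).
Hypothesis u_neq0 : u != 0.
Local Notation L := (leavitt K E).
Local Notation module := (vertex E -> nat -> A).
Implicit Types (v w : vertex E) (e f : edge E) (n m : nat) (g h : module).

(** An edge carries the values at its range to the codes reserved for it at its source, and its
    ghost carries them back. The factors [u] and [u^-1] record path length. *)
Fixpoint term_act (t : lterm K E) g : module :=
  match t with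
  | LVert v => fun w n => if w == v then g w n else 0
  | LEdge e => fun w n =>
      if decode w n is Some (f, m) then
        if f == e then u * g (rng e) m else 0
      else 0
  | LGhost e => fun w n =>
      if w == rng e then u^-1 * g (src e) (encode e n) else 0
  | LZero => fun w n => 0
  | LAdd s t => fun w n => term_act s g w n + term_act t g w n
  | LOpp s => fun w n => - term_act s g w n
  | LScale a s => fun w n => iota a * term_act s g w n
  | LMul s t => term_act s (term_act t g)
  end.

Lemma eq_module g h : (forall v n, g v n = h v n) -> g = h.
Proof. by move=> gh; apply/funext => v; apply/funext => n. Qed.

Lemma term_actD t g h :
  term_act t (fun v n => g v n + h v n) =
  fun v n => term_act t g v n + term_act t h v n.
Proof.
elim: t g h => [v|e|e||s Ps t Pt|s Ps|a s Ps|s Ps t Pt] g h; apply/eq_module => w n /=.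
- by case: ifP; rewrite ?addr0.
- by case: decode => [[f m]|]; [case: ifP|]; rewrite ?mulrDr ?addr0.
- by case: ifP; rewrite ?mulrDr ?addr0.
- by rewrite addr0.
- by rewrite Ps Pt addrACA.
- by rewrite Ps opprD.
- by rewrite Ps mulrDr.
- by rewrite Pt Ps.
Qed.

Lemma term_actZ t c g :
  term_act t (fun v n => c * g v n) = fun v n => c * term_act t g v n.
Proof.
elim: t g => [v|e|e||s Ps t Pt|s Ps|a s Ps|s Ps t Pt] g; apply/eq_module => w n /=.
- by case: ifP; rewrite ?mulr0.
- by case: decode => [[f m]|]; [case: ifP|]; rewrite ?mulr0 // mulrCA.
- by case: ifP; rewrite ?mulr0 // mulrCA.
- by rewrite mulr0.
- by rewrite Ps Pt mulrDr.
- by rewrite Ps mulrN.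
- by rewrite Ps mulrCA.
- by rewrite Pt Ps.
Qed.

Lemma lcong_term_act s t : lcong s t -> term_act s = term_act t.
Proof.
elim=> {s t} //=.
- by move=> r s t _ -> _ ->.
- by move=> s s' t t' _ -> _ ->.
- by move=> s s' _ ->.
- by move=> a s s' _ ->.
- by move=> s s' t t' _ -> _ ->.
- by move=> r s t; apply/funext => g; apply/eq_module => w n; rewrite addrA.
- by move=> s t; apply/funext => g; apply/eq_module => w n; rewrite addrC.
- by move=> s; apply/funext => g; apply/eq_module => w n; rewrite add0r.
- by move=> s; apply/funext => g; apply/eq_module => w n; rewrite addNr.
- by move=> a b s; apply/funext => g; apply/eq_module => w n; rewrite rmorphM mulrA.
- by move=> s; apply/funext => g; apply/eq_module => w n; rewrite rmorph1 mul1r.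
- by move=> a s t; apply/funext => g; apply/eq_module => w n; rewrite mulrDr.
- by move=> a b s; apply/funext => g; apply/eq_module => w n; rewrite rmorphD mulrDl.
- by move=> r s t; apply/funext => g; rewrite term_actD.
- by move=> a s t; apply/funext => g; rewrite term_actZ.
- move=> v w; apply/funext => g; apply/eq_module => t n /=.
  case: (eqVneq t v) => [->|tv]; case: (eqVneq v w) => [vw|vw] /=;
    rewrite ?vw ?eqxx ?(negPf vw) ?(negPf tv) //.
  by rewrite -vw (negPf tv).
- move=> e; apply/funext => g; apply/eq_module => w n.
  case: eqP => // /eqP we; case def_f: decode => [[f m]|] //; case: eqP => // fe.
  by have [fw _] := decodeK def_f; rewrite -fw fe eqxx in we.
- move=> e; apply/funext => g; apply/eq_module => w n.
  by rewrite eqxx.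
- move=> e; apply/funext => g; apply/eq_module => w n.
  by case: eqP.
- move=> e; apply/funext => g; apply/eq_module => w n.
  by rewrite eqxx.
- move=> e f; apply/funext => g; apply/eq_module => w n.
  rewrite encodeK; case: (eqVneq e f) => [<-|ef] /=; last by rewrite mulr0; case: eqP.
  by case: eqP => // ->; rewrite mulrA mulVf // mul1r.
- move=> v reg_v; apply/funext => g; apply/eq_module => w n.
  transitivity (\sum_(e <- fset_set (out_edges v))
      term_act (LMul (LEdge e) (LGhost e)) g w n); last first.
    elim: (enum_fset _) => [|e s IH]; first by rewrite !big_nil.
    by rewrite !big_cons /= IH.
  have [finv _] := reg_v; have uv := fset_uniq (fset_set (out_edges v)).
  case: (eqVneq w v) => [->|wv].
    (* Of all edges leaving [v], only the one decoded from [n] contributes to the sum at [n]. *)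
    have [[e m] def_e] := decode_regular n reg_v.
    have [ev enc_e] := decodeK def_e.
    rewrite (bigD1_seq e) //=; last by rewrite [_ \in _]mem_out_seq // ev.
    rewrite def_e !eqxx big1 => [|f fe]; last by rewrite eq_sym (negPf fe).
    by rewrite addr0 mulrA divff // mul1r enc_e ev.
  rewrite big_seq big1 // => e; rewrite [_ \in _]mem_out_seq // => /eqP ev /=.
  case def_f: decode => [[f m]|] //; case: eqP => // fe.
  by have [fw _] := decodeK def_f; rewrite -fw fe ev eqxx in wv.
Qed.

Definition act (x : L) : module -> module := term_act (repr x).

Lemma act_class t : act (lclass t) = term_act t.
Proof. exact/lcong_term_act/lcong_repr. Qed.

Lemma actM x y g : act (x ** y) g = act x (act y g).
Proof. by rewrite [in LHS]/numul /= act_class. Qed.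

Lemma actD x y g : act (x + y) g = fun v n => act x g v n + act y g v n.
Proof. by rewrite [in LHS]/GRing.add /= act_class. Qed.

Lemma actZ a x g : act (a *: x) g = fun v n => iota a * act x g v n.
Proof. by rewrite [in LHS]/GRing.scale /= act_class. Qed.

Lemma act0 g : act 0 g = fun _ _ => 0.
Proof. by rewrite [in LHS]/GRing.zero /= act_class. Qed.

Lemma act_scale x c g :
  act x (fun v n => c * g v n) = fun v n => c * act x g v n.
Proof. exact: term_actZ. Qed.

Lemma act_sum I (r : seq I) (F : I -> L) g :
  act (\sum_(i <- r) F i) g = fun v n => \sum_(i <- r) act (F i) g v n.
Proof.
apply/eq_module => v n; elim: r => [|i r IH]; first by rewrite !big_nil act0.
by rewrite !big_cons actD IH.
Qed.

Lemma act_lv v g w n : act (lv K v) g w n = if w == v then g w n else 0.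
Proof. by rewrite act_class. Qed.

Lemma act_lv_neq0 v : lv K v <> 0.
Proof.
move=> v0; have := act_lv v (fun _ _ => 1) v 0%N.
by rewrite v0 act0 eqxx => /eqP; rewrite eq_sym oner_eq0.
Qed.

Definition vertex_indicator w : module := fun v _ => (v == w)%:R.

(** At a vertex emitting a single edge the encoding is the identity, so each edge turns one
    indicator function into another, with a factor [u]. *)
Lemma act_real_path v p w : no_bifurcation v -> gpath v p w ->
  act (real_path K p w) (vertex_indicator w) =
  fun t n => u ^+ size p * vertex_indicator v t n.
Proof.
move=> nbv vp; apply/eq_module => t n; rewrite /vertex_indicator.
elim: p v nbv vp t n => [|e p IH] v nbv /= => [/eqP ->|/andP[/eqP ev ep]] t n.
  by rewrite act_lv mul1r; case: eqP.
have nbe : no_bifurcation (rng e).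
  by apply: no_bifurcation_tree nbv _; rewrite -ev; exact: tree_rng.
rewrite actM act_class /= /vertex_indicator; subst v.
have [->|te] := eqVneq t (src e).
  by rewrite decode_no_bifurcation // eqxx (IH _ nbe ep) eqxx !mulr1 exprS.
case def_f: decode => [[f m]|]; rewrite ?mulr0 //; case: eqP => // fe.
by have [ft _] := decodeK def_f; rewrite -ft fe eqxx in te.
Qed.

(** Meant for the set [S] of Laurent polynomials in [u]: acting on functions with such values never
    leaves it. *)
Lemma act_closed (S : A -> Prop) :
  S 0 -> (forall a b, S a -> S b -> S (a + b)) -> (forall a, S a -> S (u * a)) ->
  (forall a, S a -> S (u^-1 * a)) -> (forall k a, S a -> S (iota k * a)) ->
  forall x g, (forall v n, S (g v n)) -> forall v n, S (act x g v n).
Proof.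
move=> S0 SD Su Su' SZ x; rewrite /act.
elim: (repr x) => [v|e|e||s Ps t Pt|s Ps|a s Ps|s Ps t Pt] g Sg w n //=.
- by case: ifP.
- by case: decode => [[f m]|] //; case: ifP => // _; apply: Su.
- by case: ifP => // _; apply: Su'.
- by apply: SD; [apply: Ps | apply: Pt].
- rewrite -mulN1r -(rmorph1 iota) -rmorphN; apply: SZ; exact: Ps.
- by apply: SZ; apply: Ps.
- by apply: Ps => v m; apply: Pt.
Qed.

End Representation.

(** * Closed paths acting as powers of a variable over K(x) *)

Section ClosedPaths.
Context (K : fieldType) (E : graph).
Local Notation L := (leavitt K E).
Implicit Types (v w : vertex E) (p c : seq (edge E)) (l : seq (K * seq (edge E))).

Definition real_sum l w : L := \sum_(t <- l) t.1 *: real_path K t.2 w.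

Definition closed_paths w l : bool :=
  all (fun t => (t.2 != [::]) && gpath w t.2 w) l.

Local Notation "p %:F" := (@tofrac {poly K} p).

Let F := {fraction {poly K}}.
Let iota : {rmorphism K -> F} := (@tofrac {poly K}) \o polyC.
Let u : F := ('X : {poly K})%:F.

Let u_neq0 : u != 0.
Proof. by rewrite tofrac_eq0 polyX_eq0. Qed.

Let action : L -> _ := act iota u.

(** The scalar by which [lv K w + real_sum l w] acts on the indicator function of [w]. *)
Let length_poly l : {poly K} := 1 + \sum_(t <- l) t.1 *: 'X^(size t.2).

(** The closed paths have positive length, so the constant coefficient is 1. *)
Let length_poly_neq0 w l : closed_paths w l -> length_poly l != 0.
Proof.
move=> clo; apply/eqP => /(congr1 (fun q => q.[0])); rewrite hornerD hornerC horner0.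
rewrite horner_sum big1_seq ?addr0; first by apply/eqP; rewrite oner_eq0.
move=> t /andP[_ /(allP clo)/andP[t0 _]].
by rewrite hornerZ hornerXn expr0n size_eq0 (negPf t0) mulr0.
Qed.

Let action_real_sum w l : no_bifurcation w -> closed_paths w l ->
  action (lv K w + real_sum l w) (vertex_indicator F w) =
  fun v n => (length_poly l)%:F * vertex_indicator F w v n.
Proof.
move=> nbw clo; apply/eq_module => v n.
rewrite /action (actD iota u_neq0) (act_sum iota u_neq0) (act_lv iota u_neq0).
rewrite rmorphD rmorph1 mulrDl mul1r.
congr (_ + _); first by rewrite /vertex_indicator; case: eqP.
rewrite rmorph_sum mulr_suml big_seq [RHS]big_seq; apply: eq_bigr => t.
move=> /(allP clo)/andP[_ wt].
rewrite (actZ iota u_neq0) (act_real_path iota u_neq0 nbw wt).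
by rewrite -mul_polyC rmorphM rmorphXn mulrA.
Qed.

Let action_loop w c l : no_bifurcation w -> c != [::] -> gpath w c w ->
  closed_paths w l ->
  action ((lv K w - real_path K c w) ** (lv K w + real_sum l w)) (vertex_indicator F w) =
  fun v n => (length_poly l * (1 - 'X^(size c)))%:F * vertex_indicator F w v n.
Proof.
move=> nbw c0 wc clo; rewrite /action (actM iota u_neq0).
rewrite [act _ _ _ (vertex_indicator _ _)]action_real_sum //.
rewrite act_scale; apply/eq_module => v n.
rewrite rmorphM -mulrA; congr (_ * _).
rewrite -scaleN1r (actD iota u_neq0) (actZ iota u_neq0).
rewrite (act_real_path iota u_neq0 nbw wc).
rewrite (act_lv iota u_neq0) rmorphN rmorph1 mulN1r rmorphB rmorph1 mulrBl mul1r rmorphXn.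
by congr (_ - _); rewrite /vertex_indicator; case: eqP.
Qed.

(** It acts on the indicator function of [w] by the nonzero scalar [length_poly l]. *)
Lemma unital_closed_sum_neq0 w l : no_bifurcation w -> closed_paths w l ->
  lv K w + real_sum l w <> 0.
Proof.
move=> nbw clo y0; have := action_real_sum nbw clo; rewrite y0 /action (act0 iota u_neq0).
move=> /(congr1 (fun g => g w 0%N)); rewrite /vertex_indicator eqxx mulr1.
by move/esym/eqP; rewrite tofrac_eq0 (negPf (length_poly_neq0 clo)).
Qed.

Lemma one_sub_Xn_neq0 (n : nat) : (0 < n)%N -> 1 - 'X^n != 0 :> {poly K}.
Proof.
move=> n0; apply/eqP => /(congr1 (fun q => q.[0])).
rewrite hornerD hornerN hornerXn hornerC horner0 expr0n eqn0Ngt n0 subr0.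
by apply/eqP; rewrite oner_eq0.
Qed.

(* On the line spanned by the indicator function of [w] over K[x, 1/x], where the
   loop [c] acts as a power [x^n], an equality y = b (w - c) y would make 1 - x^n
   invertible in K[x, 1/x]. *)
Lemma loop_not_minimal w c l (z := lv K w - real_path K c w)
    (y := lv K w + real_sum l w) :
  no_bifurcation w -> c != [::] -> gpath w c w -> closed_paths w l ->
  z ** y <> 0 /\ forall b, y <> b ** (z ** y).
Proof.
move=> nbw c0 wc clo; have zyE := action_loop nbw c0 wc clo.
have c_gt0 : (0 < size c)%N by rewrite lt0n size_eq0.
have p0 := length_poly_neq0 clo.
split=> [zy0|b yE].
  move: zyE; rewrite -/z -/y zy0 /action (act0 iota u_neq0).
  move=> /(congr1 (fun g => g w 0%N)).
  rewrite /vertex_indicator eqxx mulr1 => /esym/eqP.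
  by rewrite tofrac_eq0 mulf_eq0 (negPf p0) (negPf (one_sub_Xn_neq0 c_gt0)).
have := action_real_sum nbw clo; rewrite -/y {1}yE /action (actM iota u_neq0).
rewrite [act iota u (z ** y) _]zyE act_scale.
move=> /(congr1 (fun g => g w 0%N)); rewrite {2}/vertex_indicator eqxx mulr1.
(* The scalar contributed by [b] is a Laurent polynomial; a power of [u] clears its denominator. *)
have [n [a]] : exists n (a : {poly K}),
    u ^+ n * act iota u b (vertex_indicator F w) w 0%N = a%:F.
  apply: (act_closed (S := fun s => exists n (a : {poly K}), u ^+ n * s = a%:F)).
  - by exists 0%N, 0; rewrite mulr0 rmorph0.
  - move=> r s [n [a ra]] [m [b' sb]]; exists (n + m)%N, ('X^m * a + 'X^n * b').
    rewrite tofracD !tofracM !tofracXn -ra -sb exprD mulrDr -/u.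
    by congr (_ + _); rewrite !mulrA // [u ^+ m * _]mulrC.
  - move=> s [n [a sa]]; exists n, ('X * a).
    by rewrite mulrCA sa tofracM.
  - move=> s [n [a sa]]; exists n.+1, a.
    by rewrite exprS -mulrA mulrCA mulVKf.
  - move=> k s [n [a sa]]; exists n, (k%:P * a).
    by rewrite mulrCA sa tofracM.
  - by move=> v m; exists 0%N, (v == w)%:R; rewrite mul1r /vertex_indicator;
      case: eqP => _; rewrite ?tofrac1 ?tofrac0.
set s := act _ _ _ _ _ _ => sa /(congr1 (fun r => u ^+ n * r)).
rewrite mulrCA sa -tofracXn -!tofracM => /eqP; rewrite tofrac_eq.
rewrite -mulrA [X in _ == X]mulrC => /eqP/(mulfI p0).
(* After cancelling [length_poly l], what remains is [(1 - 'X^(size c)) * a = 'X^n]; at 1 this reads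
   [0 = 1]. *)
move=> /(congr1 (fun q => q.[1])); rewrite hornerM hornerD hornerN hornerC !hornerXn.
by rewrite !expr1n subrr mul0r => /esym/eqP; rewrite oner_eq0.
Qed.

Lemma lv_neq0 w : lv K w <> 0 :> L.
Proof. exact: (act_lv_neq0 iota u_neq0). Qed.

End ClosedPaths.

(** * Reduction to a vertex *)

Section Reduction.
Context (K : fieldType) (E : graph).
Local Notation L := (leavitt K E).
Local Notation lv := (lv K).
Local Notation le := (le K).
Local Notation lg := (lg K).
Local Notation real_path := (real_path K).
Local Notation ghost_path := (ghost_path K).
Implicit Types (u v w : vertex E) (p q : seq (edge E)) (e f : edge E).
Implicit Types (x y z a b : L) (l m : seq (K * seq (edge E))) (n : nat).

Lemma real_sum_cat l m w : real_sum (l ++ m) w = real_sum l w + real_sum m w :> L.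
Proof. exact: big_cat. Qed.

Lemma real_sum_cons t l w :
  real_sum (t :: l) w = t.1 *: real_path t.2 w + real_sum l w.
Proof. exact: big_cons. Qed.

Lemma real_sum0 w : real_sum [::] w = 0 :> L.
Proof. exact: big_nil. Qed.

Lemma real_sumZ k l w :
  k *: real_sum l w = real_sum [seq (k * t.1, t.2) | t <- l] w :> L.
Proof.
rewrite /real_sum scaler_sumr big_map; apply: eq_bigr => t _.
by rewrite scalerA.
Qed.

Lemma numul_real_sum a l w :
  a ** real_sum l w = \sum_(t <- l) t.1 *: (a ** real_path t.2 w).
Proof. by rewrite numul_sumr; apply: eq_bigr => t _; rewrite -scalenuAr. Qed.

Lemma real_sum_lv l w : real_sum l w ** lv w = real_sum l w.
Proof.
by rewrite numul_suml; apply: eq_bigr => t _; rewrite -scalenuAl real_path_lv.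
Qed.

Lemma real_sum_le l e : real_sum l (src e) ** le e =
  real_sum [seq (t.1, rcons t.2 e) | t <- l] (rng e).
Proof.
rewrite numul_suml /real_sum big_map; apply: eq_bigr => t _ /=.
by rewrite -scalenuAl real_path_rcons.
Qed.

(** Every element is a finite sum of terms ending in a vertex, hence the sum of its products
    [x ** lv v] over finitely many [v]. *)
Lemma exists_lv_neq0 x : x <> 0 -> exists v, x ** lv v <> 0.
Proof.
move=> x0; apply: contrapT => xv0; apply: x0.
suff [T xE] : exists T : seq (L * vertex E), x = \sum_(t <- T) t.1 ** lv t.2.
  have -> : x = \sum_(v <- undup [seq t.2 | t <- T]) x ** lv v.
    transitivity (\sum_(v <- undup [seq t.2 | t <- T])
        \sum_(t <- T) t.1 ** lv t.2 ** lv v); last first.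
      by apply: eq_bigr => v _; rewrite xE numul_suml.
    rewrite xE exchange_big /=; apply: eq_big_seq => t tT.
    rewrite (bigD1_seq t.2) ?undup_uniq ?mem_undup ?map_f //= big1.
      by rewrite addr0 -numulA lvv.
    by move=> v vt; rewrite -numulA lvM eq_sym (negPf vt) numulr0.
  rewrite big1 // => v _; apply: contrapT => xv; apply: xv0; by exists v.
elim/leavitt_gen_ind: x {xv0} => [v|e|e|x y [S ->] [T ->]|k x [T ->]|x y _ [T ->]|].
- by exists [:: (lv v, v)]; rewrite big_seq1 lvv.
- by exists [:: (le e, rng e)]; rewrite big_seq1 le_lv.
- by exists [:: (lg e, src e)]; rewrite big_seq1 lg_lv.
- by exists (S ++ T); rewrite big_cat.
- exists [seq (k *: t.1, t.2) | t <- T]; rewrite scaler_sumr big_map.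
  by apply: eq_bigr => t _; rewrite scalenuAl.
- exists [seq (x ** t.1, t.2) | t <- T]; rewrite numul_sumr big_map.
  by apply: eq_bigr => t _; rewrite numulA.
- by exists [::]; rewrite big_nil.
Qed.

(* [x] is a combination of monomials [p q^*] with [q] of length at most [n]
   starting at [v]. *)
Fixpoint ghost_height n v x : Prop :=
  if n is n'.+1 then
    exists l (T : seq (edge E * L)),
      (forall t, t \in T -> src t.1 = v /\ ghost_height n' (rng t.1) t.2) /\
      x = real_sum l v + \sum_(t <- T) t.2 ** lg t.1
  else exists l, x = real_sum l v.

Lemma ghost_height_real n v l : ghost_height n v (real_sum l v).
Proof.
case: n => [|n]; first by exists l.
by exists l, [::]; split=> //; rewrite big_nil addr0.
Qed.

Lemma ghost_height0 n v : ghost_height n v 0.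
Proof. by rewrite -(real_sum0 v); exact: ghost_height_real. Qed.

Lemma ghost_heightD n v x y :
  ghost_height n v x -> ghost_height n v y -> ghost_height n v (x + y).
Proof.
case: n => [|n] /=; first by move=> [l ->] [m ->]; exists (l ++ m); rewrite real_sum_cat.
move=> [l [S [hS ->]]] [m [T [hT ->]]]; exists (l ++ m), (S ++ T); split.
  by move=> t; rewrite mem_cat => /orP[/hS|/hT].
by rewrite real_sum_cat big_cat addrACA.
Qed.

Lemma ghost_height_sum n v (I : eqType) (r : seq I) (F : I -> L) :
  (forall i, i \in r -> ghost_height n v (F i)) ->
  ghost_height n v (\sum_(i <- r) F i).
Proof.
move=> hF; rewrite big_seq; elim/big_ind: _ => //.
  exact: ghost_height0.
exact: ghost_heightD.
Qed.

Lemma ghost_heightZ n v k x : ghost_height n v x -> ghost_height n v (k *: x).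
Proof.
elim: n v x => [|n IH] v x /= => [[l ->]|[l [T [hT ->]]]].
  by eexists; exact: real_sumZ.
rewrite scalerDr real_sumZ scaler_sumr.
exists [seq (k * t.1, t.2) | t <- l], [seq (t.1, k *: t.2) | t <- T]; split.
  by move=> _ /mapP[t /hT[tv ht] ->]; split=> //; exact: IH.
by congr (_ + _); rewrite big_map; apply: eq_bigr => t _; rewrite scalenuAl.
Qed.

Lemma ghost_heightS n v x : ghost_height n v x -> ghost_height n.+1 v x.
Proof.
elim: n v x => [|n IH] v x; first by move=> [l ->]; exact: ghost_height_real.
move=> [l [T [hT ->]]]; exists l, T; split=> // t /hT[tv ht].
by split=> //; exact: IH.
Qed.

Lemma ghost_height_leq n n' v x :
  (n <= n')%N -> ghost_height n v x -> ghost_height n' v x.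
Proof.
move=> /subnKC <-; elim: (n' - n)%N => [|k IH]; first by rewrite addn0.
by rewrite addnS => /IH; exact: ghost_heightS.
Qed.

Lemma ghost_height_lv n v x : ghost_height n v x -> x ** lv v = x.
Proof.
case: n => [[l ->]|n [l [T [hT ->]]]]; first exact: real_sum_lv.
rewrite numulDl real_sum_lv numul_suml; congr (_ + _); apply: eq_big_seq => t.
by move=> /hT[<- _]; rewrite -numulA lg_lv.
Qed.

(** Ghosts stand on the right, so left multiplication by [y] meets only the real paths in front of
    them. *)
Lemma ghost_height_mul y :
  (forall p v, ghost_height 1 v (y ** real_path p v)) ->
  forall n v x, ghost_height n v x -> ghost_height n.+1 v (y ** x).
Proof.
move=> hy.
have hy1 l v : ghost_height 1 v (y ** real_sum l v).
  by rewrite numul_real_sum; apply: ghost_height_sum => t _; exact: ghost_heightZ.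
elim=> [|n IH] v x; first by move=> [l ->].
move=> [l [T [hT ->]]]; rewrite numulDr; apply: ghost_heightD.
  exact: ghost_height_leq (hy1 l v).
exists [::], [seq (t.1, y ** t.2) | t <- T]; split.
  by move=> _ /mapP[t /hT[tv ht] ->]; split=> //; exact: IH.
rewrite real_sum0 add0r numul_sumr big_map.
by apply: eq_bigr => t _; rewrite numulA.
Qed.

Lemma ghost_height_path n p w : ghost_height n w (real_path p w).
Proof.
have := ghost_height_real n w [:: (1, p)].
by rewrite /real_sum big_seq1 scale1r.
Qed.

Lemma exists_ghost_height x v : exists n, ghost_height n v (x ** lv v).
Proof.
(* Generalized from [lv v] to any [y], so that the induction passes through products. *)
suff: forall n y, ghost_height n v y -> exists n', ghost_height n' v (x ** y).
  by apply; exact: (ghost_height_path 0 [::]).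
elim/leavitt_gen_ind: x => [w|e|e|x y hx hy|k x hx|x y hx hy|] n z hz.
- exists n.+1; apply: ghost_height_mul hz => p t.
  case: (lv_real_path_if K w p t) => ->; first exact: ghost_height_path.
  exact: ghost_height0.
- exists n.+1; apply: ghost_height_mul hz => p t.
  exact: (ghost_height_path 1 (e :: p)).
(* Before an empty path the ghost survives, at height one; before a nonempty path it cancels the
   first edge or gives 0. *)
- exists n.+1; apply: ghost_height_mul hz => -[|f p] t.
    rewrite [real_path _ _]/= lg_lv_if; case: eqP => [et|_]; last exact: ghost_height0.
    exists [::], [:: (e, lv (rng e))]; split; last first.
      by rewrite big_seq1 real_sum0 add0r lv_lg.
    move=> s; rewrite inE => /eqP -> /=; split=> //.
    exact: (ghost_height_path 0 [::]).
  rewrite [real_path _ _]/= numulA lg_le; case: eqP => _; last first.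
    by rewrite numul0l; exact: ghost_height0.
  case: (lv_real_path_if K (rng e) p t) => ->; first exact: ghost_height_path.
  exact: ghost_height0.
- have [i hi] := hx n z hz; have [j hj] := hy n z hz; exists (maxn i j).
  rewrite numulDl; apply: ghost_heightD.
    exact: ghost_height_leq (leq_maxl _ _) hi.
  exact: ghost_height_leq (leq_maxr _ _) hj.
- by have [i hi] := hx n z hz; exists i; rewrite -scalenuAl; exact: ghost_heightZ.
- by have [i /hx[j hj]] := hy n z hz; exists j; rewrite -numulA.
- by exists 0%N; rewrite numul0l; exact: ghost_height0.
Qed.

(** * From collected real paths to a vertex plus closed paths *)

Definition reduced m w : Prop :=
  uniq [seq t.2 | t <- m] /\
  forall t, t \in m -> t.1 != 0 /\ exists v, gpath v t.2 w.

(** A term is dropped if its coefficient is 0 or its path invalid, and merged with a term having the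
    same path. *)
Lemma exists_reduced l w : exists2 m, reduced m w & real_sum l w = real_sum m w :> L.
Proof.
elim: l => [|[k p] l [m [um mP] lE]]; first by exists [::].
have [k0|k0] := eqVneq k 0.
  by exists m => //; rewrite real_sum_cons k0 scale0r add0r.
have [[v vp]|inv] := pselect (exists v, gpath v p w); last first.
  exists m => //; rewrite real_sum_cons /= real_path_invalid ?scaler0 ?add0r //.
  by move=> v; apply/negP => vp; apply: inv; exists v.
have [/mapP[t tm tp]|pm] := boolP (p \in [seq t.2 | t <- m]); last first.
  exists ((k, p) :: m); last by rewrite !real_sum_cons lE.
  split; first by rewrite /= pm.
  move=> t; rewrite inE => /orP[/eqP ->|/mP //].
  by split=> //; exists v.
have mt := perm_to_rem tm; have := um; rewrite (perm_uniq (perm_map _ mt)) /=.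
move=> /andP[trem urem].
have remP s : s \in rem t m -> s.1 != 0 /\ exists v, gpath v s.2 w.
  by move=> /mem_rem/mP.
have sumE : real_sum ((k, p) :: l) w = (k + t.1) *: real_path p w + real_sum (rem t m) w.
  rewrite real_sum_cons lE /real_sum (perm_big _ mt) big_cons /= -tp.
  by rewrite addrA scalerDl.
have [kt|kt] := eqVneq (k + t.1) 0.
  by exists (rem t m); rewrite ?sumE ?kt ?scale0r ?add0r.
exists ((k + t.1, p) :: rem t m); last by rewrite sumE real_sum_cons.
split; first by rewrite /= tp trem.
move=> s; rewrite inE => /orP[/eqP ->|/remP //].
by split=> //; exists v.
Qed.

Lemma reduced_rcons m e : reduced m (src e) ->
  reduced [seq (t.1, rcons t.2 e) | t <- m] (rng e).
Proof.
move=> [um mP]; split.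
  rewrite -map_comp (map_comp (rcons^~ e) snd) map_inj_uniq //.
  exact: rcons_injl.
move=> _ /mapP[t /mP[t0 [v vt]] ->]; split=> //=; exists v.
by rewrite -cats1; apply: gpath_cat vt _; rewrite /= !eqxx.
Qed.

(* If x e = 0 for every edge e leaving v, then x = a - sum of a e e^*, where a is
   the ghost-free part of x and e runs over the edges whose ghosts end x. *)
Lemma ghost_free_multiple n v x : ghost_height n v x -> x <> 0 ->
  exists p w m, [/\ gpath v p w, reduced m w, m != [::]
    & x ** real_path p w = real_sum m w].
Proof.
elim: n v x => [|n IH] v x hx x0.
  have [l xE] := hx; have [m rm lE] := exists_reduced l v.
  exists [::], v, m; split=> //=; last by rewrite xE real_sum_lv.
  by apply/eqP => m0; apply: x0; rewrite xE lE m0 real_sum0.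
have [l [T [hT xE]]] := hx; have [m rm lE] := exists_reduced l v.
rewrite {}lE in xE; set g := \sum_(t <- T) _ in xE.
(* Multiplication by [e] strips the last ghost of each term or kills the term, so the height
   drops. *)
have [[e [ev xe]]|xe0] := pselect (exists e, src e = v /\ x ** le e <> 0).
  have [|//|p [w [m' [ep rm' m'0 xp]]]] := IH (rng e) (x ** le e).
    rewrite xE numulDl -ev real_sum_le; apply: ghost_heightD.
      exact: ghost_height_real.
    rewrite numul_suml; apply: ghost_height_sum => t tT.
    have [_ ht] := hT t tT; rewrite -numulA lg_le; case: eqP => [<-|_].
      by rewrite (ghost_height_lv ht).
    by rewrite numulr0; exact: ghost_height0.
  exists (e :: p), w, m'; split=> //; first by rewrite /= ev eqxx.
  by rewrite -xp /= numulA.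
have {}xe0 e : src e = v -> x ** le e = 0.
  by move=> ev; apply: contrapT => xe; apply: xe0; exists e.
set S := undup [seq t.1 | t <- T].
have SP e : e \in S -> src e = v.
  by rewrite mem_undup => /mapP[t /hT[tv _] ->].
have gE : g = - (real_sum m v ** \sum_(e <- S) le e ** lg e).
  rewrite -numulNl numul_sumr.
  transitivity (\sum_(e <- S) \sum_(t <- T) t.2 ** lg t.1 ** (le e ** lg e)).
    rewrite exchange_big /=; apply: eq_big_seq => t tT.
    rewrite (bigD1_seq t.1) ?undup_uniq ?mem_undup ?map_f //= big1.
      by rewrite addr0 -numulA (numulA (lg _)) lg_le eqxx lv_lg.
    move=> e et; rewrite -numulA (numulA (lg _)) lg_le eq_sym (negPf et).
    by rewrite numul0l numulr0.
  apply: eq_big_seq => e /SP ev; rewrite -numul_suml -/g.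
  have -> : g = x - real_sum m v by rewrite xE addrC addKr.
  by rewrite numulA numulBl xe0 // sub0r -numulNl -numulA.
have m0 : m != [::].
  by apply/eqP => m0; apply: x0; rewrite xE gE m0 real_sum0 numul0l oppr0 addr0.
have [S0|S0] := eqVneq S [::].
  exists [::], v, m; split=> //=.
  by rewrite xE gE S0 big_nil numulr0 oppr0 addr0 real_sum_lv.
(* An edge [f] at [v] outside [S] kills all the ghost terms and leaves the real part times [f]. *)
have [[f [fv fS]]|allS] := pselect (exists f, src f = v /\ f \notin S).
  exists [:: f], (rng f), [seq (t.1, rcons t.2 f) | t <- m]; split.
  - by rewrite /= fv !eqxx.
  - by apply: reduced_rcons; rewrite fv.
  - by case: m m0 {rm xE gE}.
  - rewrite /= le_lv -real_sum_le fv xE gE numulDl numulNl -numulA numul_suml.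
    rewrite big1_seq ?numulr0 ?oppr0 ?addr0 // => e /andP[_ eS].
    rewrite -numulA lg_le; case: eqP => [ef|_]; last by rewrite numulr0.
    by rewrite -ef eS in fS.
(* If [S] consists of all edges at [v], relation (4) turns the sum of the [e e^*] into [v], and [x]
   vanishes. *)
case: x0; rewrite xE gE -(@lv_regular K E v S) ?undup_uniq //.
  by rewrite real_sum_lv subrr.
move=> e; apply/idP/eqP => [/SP //|ev].
by apply: contrapT => /negP eS; apply: allS; exists e.
Qed.

(** The bound on the number of terms serves the induction that removes loops. *)
Lemma compress_real_sum a b l w w' :
  (forall t, t \in l -> a ** real_path t.2 w ** b = 0 \/
     exists q, [/\ q != [::], gpath w' q w'
                & a ** real_path t.2 w ** b = real_path q w']) ->
  exists l', [/\ closed_paths w' l', (size l' <= size l)%N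
    & a ** real_sum l w ** b = real_sum l' w'].
Proof.
elim: l => [|t l IH] lP.
  by exists [::]; rewrite !real_sum0 numulr0 numul0l.
have [|l' [clo szl' l'E]] := IH; first by move=> s sl; apply: lP; rewrite inE sl orbT.
rewrite real_sum_cons numulDr numulDl l'E -scalenuAr -scalenuAl.
have [->|[q [q0 qw ->]]] := lP t (mem_head _ _).
  by exists l'; rewrite scaler0 add0r; split=> //; exact: leqW.
exists ((t.1, q) :: l'); rewrite real_sum_cons; split=> //=.
by rewrite q0 qw.
Qed.

Lemma exists_minsize m : m != [::] ->
  exists2 t, t \in m & forall s, s \in m -> (size t.2 <= size s.2)%N.
Proof.
elim: m => [//|t m IH] _; have [->|/IH[s sm smin]] := eqVneq m [::].
  by exists t; rewrite ?mem_head // => s; rewrite inE => /eqP ->.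
have [ts|/ltnW st] := leqP (size t.2) (size s.2).
  exists t; rewrite ?mem_head // => r; rewrite inE => /orP[/eqP -> //|/smin].
  exact: leq_trans.
exists s; first by rewrite inE sm orbT.
by move=> r; rewrite inE => /orP[/eqP ->|/smin].
Qed.

(** Multiplying by the ghost of a shortest path [t.2] turns its own term into [w]. Another path
    either vanishes or extends [t.2], and then leaves a nontrivial closed path. *)
Lemma vertex_multiple m w : reduced m w -> m != [::] ->
  exists a l, closed_paths w l /\ a ** real_sum m w = lv w + real_sum l w.
Proof.
move=> [um mP] /exists_minsize[t tm tmin].
have mt := perm_to_rem tm; have := um; rewrite (perm_uniq (perm_map _ mt)) /=.
move=> /andP[trem _]; have [t0 [v vt]] := mP t tm.
have [|l [clo _ lE]] := @compress_real_sum (ghost_path t.2 w) (lv w) (rem t m) w w.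
  move=> s srem; have sm := mem_rem srem; have [_ [v' vs]] := mP s sm.
  rewrite -numulA real_path_lv.
  have st : t.2 <> s.2 by move=> st; case/negP: trem; apply/mapP; exists s.
  have [pts|npts] := boolP (prefix t.2 s.2).
    have [q sE] := prefixP pts; have := vs; rewrite sE => /gpath_catP[w' tw' w'q].
    (* The two ranges can differ only if [t.2] is empty. *)
    have [ww'|ww'] := eqVneq w w'; last first.
      left; rewrite (real_path_cat _ _ w'q) numulA ghost_real_neq //.
      by rewrite numul0l.
    subst w'; right; exists q; split=> //; last exact: ghost_real_prefix tw' w'q.
    by apply/eqP => q0; apply: st; rewrite sE q0 cats0.
  left; apply: ghost_real_not_prefix => //; apply/negP => /prefixP[q tE].
  have := tmin s sm; rewrite tE size_cat -{2}[size s.2]addn0 leq_add2l leqn0 size_eq0.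
  by move=> /eqP q0; apply: st; rewrite tE q0 cats0.
exists (t.1^-1 *: ghost_path t.2 w), [seq (t.1^-1 * s.1, s.2) | s <- l]; split.
  by rewrite /closed_paths all_map.
rewrite -real_sumZ -lE /real_sum (perm_big _ mt) big_cons /= numulDr.
rewrite -!scalenuAl -scalenuAr scalerA mulVf // scale1r (ghost_real K vt).
by congr (_ + _); rewrite -numulA real_sum_lv.
Qed.

(** Take [r] to be [p] followed by [e] or by [f]. As [q] is nonempty, the edge of [q ++ r] at
    position [size p] does not depend on this choice, so it differs from [e] or from [f]. *)
Lemma bifurcation_avoid w v p q : q != [::] -> gpath w p v -> bifurcation v ->
  exists r v', [/\ r != [::], gpath w r v' & ~~ prefix r (q ++ r)].
Proof.
move=> q0 wp /bifurcationP[e [f [ev fv ef]]].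
have rP g : src g = v -> rcons p g != [::] /\ gpath w (rcons p g) (rng g).
  move=> gv; split; first by case: (p).
  by rewrite -cats1; apply: gpath_cat wp _; rewrite /= gv !eqxx.
have eqnth g : prefix (rcons p g) (q ++ rcons p g) -> nth e (q ++ p) (size p) = g.
  move=> /prefixP[r]; move/(congr1 (fun s => nth e s (size p))).
  rewrite [RHS]nth_cat size_rcons ltnSn nth_rcons ltnn eqxx => <-.
  rewrite -cats1 catA [RHS]nth_cat size_cat.
  by rewrite -{2}[size p]add0n ltn_add2r lt0n size_eq0 q0.
have [/eqnth pe|npe] := boolP (prefix (rcons p e) (q ++ rcons p e)); last first.
  by have [? ?] := rP e ev; exists (rcons p e), (rng e).
have [/eqnth pf|npf] := boolP (prefix (rcons p f) (q ++ rcons p f)); last first.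
  by have [? ?] := rP f fv; exists (rcons p f), (rng f).
by case: ef; rewrite -pe -pf.
Qed.

(** While the tree of [w] has a bifurcation, choose [r] avoiding the first loop [t]: then
    [r^* t r = 0], [r^* w r] is a vertex, and every other loop vanishes or becomes a loop there.
    Fewer terms remain each time. *)
Lemma remove_loops l w : closed_paths w l ->
  exists a p w' l', [/\ gpath w p w', closed_paths w' l',
    l' = [::] \/ no_bifurcation w'
    & a ** (lv w + real_sum l w) ** real_path p w' = lv w' + real_sum l' w'].
Proof.
have [n] := ubnP (size l); elim: n l w => // n IH [|t l] w ltln clo.
  exists (lv w), [::], w, [::]; split=> //=; first by left.
  by rewrite real_sum0 addr0 !lvv.
have [nbw|] := pselect (no_bifurcation w).
  exists (lv w), [::], w, (t :: l); split=> //=; first by right.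
  rewrite numulDr lvv numulDl lvv -numulA real_sum_lv; congr (_ + _).
  rewrite numul_real_sum; apply: eq_big_seq => s /(allP clo)/andP[_ ws].
  by rewrite lv_real_path.
move=> /existsNP[v /not_implyP[[p wp] /contrapT bv]].
have /andP[/andP[t0 wt] clo'] := clo.
have [r [w1 [r0 wr ntr]]] := bifurcation_avoid t0 wp bv.
have redE s : gpath w s.2 w -> ghost_path r w1 ** real_path s.2 w ** real_path r w1 =
    ghost_path r w1 ** real_path (s.2 ++ r) w1.
  by move=> ws; rewrite (real_path_cat _ _ wr) numulA.
have longer q : q != [::] -> ~~ prefix (q ++ r) r.
  move=> q0; apply/negP => /size_prefix.
  by rewrite size_cat -{2}[size r]add0n leq_add2r leqn0 size_eq0 (negPf q0).
have vE : ghost_path r w1 ** lv w ** real_path r w1 = lv w1.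
  by rewrite (ghost_path_lv _ wr) (ghost_real _ wr).
have tE : ghost_path r w1 ** real_path t.2 w ** real_path r w1 = 0.
  by rewrite redE // ghost_real_not_prefix // longer.
have [|l1 [clo1 szl1 l1E]] :=
    @compress_real_sum (ghost_path r w1) (real_path r w1) l w w1.
  move=> s /(allP clo')/andP[s0 ws]; rewrite redE //.
  have [|nrs] := boolP (prefix r (s.2 ++ r)); last first.
    by left; rewrite ghost_real_not_prefix // longer.
  move=> /prefixP[q rq]; have := gpath_cat ws wr; rewrite rq.
  move=> /gpath_catP[w2 wr2 w2q]; have w21 := gpath_rng wr2 wr; subst w2.
  right; exists q; split=> //; last exact: ghost_real_prefix wr w2q.
  (* From [s.2 ++ r = r ++ q], the loop [q] is as long as [s.2], hence nontrivial. *)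
  rewrite -size_eq0; have /(congr1 size) := rq; rewrite !size_cat addnC.
  by move=> /addnI <-; rewrite size_eq0.
have [|a [p' [w' [l' [w1p' clol' l'P l'E]]]]] := IH l1 w1 _ clo1.
  exact: leq_ltn_trans szl1 ltln.
exists (a ** ghost_path r w1), (r ++ p'), w', l'; split=> //.
  exact: gpath_cat wr w1p'.
rewrite -l'E (real_path_cat _ _ w1p').
have <- : ghost_path r w1 ** (lv w + real_sum (t :: l) w) ** real_path r w1 =
    lv w1 + real_sum l1 w1.
  rewrite real_sum_cons !(numulDr, numulDl) vE l1E -scalenuAr -scalenuAl tE.
  by rewrite scaler0 add0r.
by rewrite !numulA.
Qed.

(** Three reductions in turn: ghosts are cleared from the right, a shortest path is cancelled from
    the left, and loops are removed by conjugation. *)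
Lemma reduction x v : x ** lv v <> 0 ->
  exists a p w l, [/\ gpath v p w, closed_paths w l,
    l = [::] \/ no_bifurcation w
    & a ** x ** real_path p w = lv w + real_sum l w].
Proof.
move=> xv0; have [n hn] := exists_ghost_height x v.
have [p [w [m [vp rm m0 xE]]]] := ghost_free_multiple hn xv0.
have [b [l [clo bE]]] := vertex_multiple rm m0.
have [a [q [w' [l' [wq clo' l'P aE]]]]] := remove_loops clo.
exists (a ** b), (p ++ q), w', l'; split=> //; first exact: gpath_cat vp wq.
rewrite -aE -bE -xE (real_path_cat _ _ wq) !numulA.
by rewrite -(numulA _ (lv v)) (lv_real_path _ vp).
Qed.

Lemma reduction_multiple_neq0 x v p w a l : closed_paths w l ->
  l = [::] \/ no_bifurcation w ->
  a ** x ** real_path p w = lv w + real_sum l w -> a ** x <> 0.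
Proof.
move=> clo lP aE ax0; move: aE; rewrite ax0 numul0l => /esym.
case: lP => [->|nbw]; last exact: unital_closed_sum_neq0.
by rewrite real_sum0 addr0; exact: lv_neq0.
Qed.

End Reduction.

(** * Minimal left ideals *)

Section Socle.
Context (K : fieldType) (E : graph).
Local Notation L := (leavitt K E).
Local Notation lv := (lv K).
Local Notation real_path := (real_path K).
Local Notation ghost_path := (ghost_path K).
Implicit Types (u v w : vertex E) (p q : seq (edge E)) (e f : edge E).
Implicit Types (x y z a b : L).

(** Guarantees that the left multiples of a nonzero element form a nonzero left ideal, in place of a
    unit. *)
Lemma exists_left_multiple_neq0 x : x <> 0 -> exists a, a ** x <> 0.
Proof.
move=> /exists_lv_neq0[v /reduction[a [p [w [l [_ clo lP aE]]]]]].
by exists a; exact: reduction_multiple_neq0 clo lP aE.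
Qed.

Lemma line_point_no_bifurcation u : line_point u -> no_bifurcation u.
Proof. by move=> lu w /lu[]. Qed.

Lemma line_point_closed_path u v p :
  line_point u -> tree u v -> gpath v p v -> p = [::].
Proof.
move=> lu uv vp; apply: contrapT => /eqP p0; have [_] := lu v uv; apply.
exact: closed_path_cycle p0 vp.
Qed.

(** No closed paths can remain after the reduction, so [a x p = w]. Multiplying by [p] on the left
    and [p^*] on the right gives [p p^* = u]. *)
Lemma line_point_multiple u x : line_point u -> x ** lv u <> 0 ->
  exists a, lv u = a ** (x ** lv u).
Proof.
move=> lu /reduction[a [p [w [l [up clo lP aE]]]]].
have l0 : l = [::].
  case: l clo {lP aE} => [//|t l] /andP[/andP[t0 wt] _].
  by move: t0; rewrite (line_point_closed_path lu _ wt) //; exists p.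
exists (real_path p w ** a); rewrite l0 real_sum0 addr0 in aE.
have nbu := line_point_no_bifurcation lu.
rewrite -[lv u in RHS](real_ghost K nbu up) !numulA.
rewrite -(numulA (real_path p w) a x) -(numulA (real_path p w) (a ** x)) aE.
by rewrite real_path_lv (real_ghost K nbu up).
Qed.

Lemma line_point_minimal u : line_point u ->
  minimal_left_ideal [set y : L | exists a, y = a ** lv u].
Proof.
move=> lu; split; first exact: left_ideal_principal.
- move=> I0; apply: (@lv_neq0 K E u).
  suff: [set y : L | exists a, y = a ** lv u] (lv u) by rewrite I0.
  by exists (lv u); rewrite lvv.
- move=> J idJ JI; have [->|nJ0] := pselect (J = [set 0]); [by left | right].
  apply/seteqP; split=> // _ [b ->]; have [_ _ JM] := idJ.
  have [x Jx x0] := left_ideal_neq0 idJ nJ0; have [a xE] := JI x Jx.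
  rewrite xE in x0; have [c ->] := line_point_multiple lu x0.
  by rewrite -xE; do 2 apply: (JM).
Qed.

(** An elementwise substitute for minimality of an ideal, inherited by right multiples of [y]. *)
Definition minimal_elt y : Prop := forall z, z ** y <> 0 -> exists b, y = b ** (z ** y).

(** The left multiples of [z ** x] form a nonzero left ideal inside [I], hence all of [I], and so
    include [x]. *)
Lemma minimal_left_ideal_elt (I : set L) x c :
  minimal_left_ideal I -> I x -> minimal_elt (x ** c).
Proof.
move=> [[I0 IB IM] nI0 minI] Ix z; rewrite numulA => zxc0.
have zx0 : z ** x <> 0 by move=> zx0; apply: zxc0; rewrite zx0 numul0l.
have [a azx0] := exists_left_multiple_neq0 zx0.
have [| JE|JE] := minI _ (left_ideal_principal (z ** x)).
- by move=> _ [b ->]; do 2 apply: (IM).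
- case: azx0; have : [set y | exists b, y = b ** (z ** x)] (a ** (z ** x)) by exists a.
  by rewrite JE.
- have [b xE] : [set y | exists b, y = b ** (z ** x)] x by rewrite JE.
  by exists b; rewrite numulA -xE.
Qed.

(** Conjugation by a path [p] from [w] to [w'] turns [w = b z p^*] into [w' = p^* b z w']. *)
Lemma minimal_elt_tree w w' : minimal_elt (lv w) -> tree w w' -> minimal_elt (lv w').
Proof.
move=> minw [p wp] z zw'.
have [|b bE] := minw (z ** ghost_path p w').
  rewrite -numulA (ghost_path_lv _ wp) => zp; apply: zw'.
  by rewrite -(ghost_real K wp) numulA zp numul0l.
exists (ghost_path p w' ** b).
have /(congr1 (fun x => ghost_path p w' ** x ** real_path p w')) := bE.
rewrite (ghost_path_lv _ wp) (ghost_real _ wp) => {1}->.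
rewrite -!numulA (lv_real_path _ wp) (ghost_real _ wp) //.
Qed.

(** If [w = b e e^*], multiplying by another edge [f] at [w] gives [f = 0], although [f^* f] is a
    vertex. *)
Lemma minimal_elt_not_bifurcation w : minimal_elt (lv w) -> ~ bifurcation w.
Proof.
move=> minw /bifurcationP[e [f [ew fw ef]]].
have lf : lg K e ** le K f = 0 by rewrite lg_le; case: eqP.
have [|b bE] := minw (le K e ** lg K e).
  rewrite -numulA -ew lg_lv => ee0; apply: (@lv_neq0 K E (rng e)).
  have <- : lg K e ** (le K e ** lg K e) ** le K e = lv (rng e).
    by rewrite numulA lg_le eqxx lv_lg lg_le eqxx.
  by rewrite ee0 numulr0 numul0l.
have := lg_le K f f; rewrite eqxx -{1}(lv_le K f) fw bE => /esym.
rewrite -(numulA (le K e)) -{1}ew lg_lv -(numulA b) -(numulA (le K e)) lf.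
by rewrite !numulr0; exact: lv_neq0.
Qed.

Lemma minimal_elt_line_point w : minimal_elt (lv w) -> line_point w.
Proof.
move=> minw.
have nbw : no_bifurcation w.
  by move=> v /(minimal_elt_tree minw)/minimal_elt_not_bifurcation.
move=> v wv; split; first exact: nbw.
move=> [c [c0 vc _]]; have minv := minimal_elt_tree minw wv.
have nbv := no_bifurcation_tree nbw wv.
(* With the empty list of closed paths, [y] is the vertex [v] itself. *)
have [] := @loop_not_minimal K E v c [::] nbv c0 vc isT.
rewrite real_sum0 addr0 => zv0 nb.
by have [b /nb] := minv _ zv0.
Qed.

End Socle.

Theorem corollary5p3 (E : graph) (K : fieldType) :
  socle (leavitt K E) <> [set 0] <-> line_points E !=set0.
Proof.
rewrite socle_neq0P; split=> [[I minI]|[u lu]]; last first.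
  by eexists; exact: line_point_minimal lu.
have [idI nI0 _] := minI; have [x Ix x0] := left_ideal_neq0 idI nI0.
have [v /reduction[a [p [w [l [vp clo lP aE]]]]]] := exists_lv_neq0 x0.
exists w; apply: (@minimal_elt_line_point K).
have Iax : I (a ** x) by have [_ _ IM] := idI; exact: IM.
have miny := minimal_left_ideal_elt (c := real_path K p w) minI Iax.
rewrite aE in miny; case: l lP clo miny {aE} => [|t l] lP clo miny.
  by move: miny; rewrite real_sum0 addr0.
case: lP => // nbw; have /andP[/andP[t0 wt] _] := clo.
(* The first closed path of the sum serves as the loop, which excludes a nonempty list. *)
have [zy nb] := loop_not_minimal nbw t0 wt clo.
by have [b /nb] := miny _ zy.
Qed.
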